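(* Let $K$ be the digraph with vertex set $\{a,b,c,d\}$ whose sides are exactly: an edge between $a$ and $b$, an edge between $c$ and $d$, and the four arrows $a\to c$, $a\to d$, $b\to c$, $b\to d$. Then $K$ is not of finite type, i.e., the Hecke-Kiselman monoid $H_K$ is infinite.
   Context: A digraph $Q$ is a graph with at most one connection (side) between each pair of distinct vertices and no loops; each side is either an oriented arrow $i\to j$ or a non-oriented edge. The Hecke-Kiselman monoid $H_Q$ is the monoid generated by elements $a_i$, one for each vertex $i$ of $Q$, subject to the relations: $a_i^2=a_i$ for all $i$; $a_ia_j=a_ja_i$ if $i,j$ are not connected; $a_ia_ja_i=a_ja_ia_j$ if $i,j$ are connected by an edge; $a_ia_j=a_ia_ja_i=a_ja_ia_j$ if there is an arrow from $i$ to $j$. The digraph $Q$ is of finite type if $H_Q$ is finite. Thus $H_K$ is the monoid generated by idempotents $a,b,c,d$ with relations $aba=bab$, $cdc=dcd$, $ac=aca=cac$, $ad=ada=dad$, $bc=bcb=cbc$, $bd=bdb=dbd$. *)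

(* Defs.v *)
From HB Require Import structures.
From mathcomp Require Import all_boot.
From mathcomp Require Import boolp classical_sets cardinality.

Set Implicit Arguments.
Unset Strict Implicit.
Unset Printing Implicit Defensive.

Local Open Scope quotient_scope.

(* [edge i j]: a non-oriented side between i and j; [arrow i j]: i -> j. *)
Record digraph := Digraph {
  vertex :> choiceType;
  edge : rel vertex;
  arrow : rel vertex;
  edge_irr : irreflexive edge;
  arrow_irr : irreflexive arrow;
  edge_sym : symmetric edge;
  arrow_asym : forall i j, arrow i j -> ~~ arrow j i;
  edge_not_arrow : forall i j, edge i j -> ~~ arrow i j
}.

Definition connected (Q : digraph) : rel Q :=
  fun i j => [|| edge i j, arrow i j | arrow j i].

(* The word [:: i1; ...; in] stands for the product a_i1 ... a_in. *)
Inductive hk_relation (Q : digraph) : seq Q -> seq Q -> Prop :=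
| hk_idem i : hk_relation [:: i; i] [:: i]
| hk_comm i j : ~~ connected i j -> hk_relation [:: i; j] [:: j; i]
| hk_edge i j : edge i j -> hk_relation [:: i; j; i] [:: j; i; j]
| hk_arrowl i j : arrow i j -> hk_relation [:: i; j] [:: i; j; i]
| hk_arrowr i j : arrow i j -> hk_relation [:: i; j; i] [:: j; i; j].

(* Monoid congruence on the free monoid generated by [hk_relation]. *)
Inductive hk_cong (Q : digraph) : seq Q -> seq Q -> Prop :=
| hk_cong_rel u v : hk_relation u v -> hk_cong u v
| hk_cong_refl u : hk_cong u u
| hk_cong_sym u v : hk_cong u v -> hk_cong v u
| hk_cong_trans u v w : hk_cong u v -> hk_cong v w -> hk_cong u w
| hk_cong_cat u u' v v' :
    hk_cong u u' -> hk_cong v v' -> hk_cong (u ++ v) (u' ++ v').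

Section HeckeKiselman.
Variable Q : digraph.

Definition hk_congb : rel (seq Q) := fun u v => `[< hk_cong u v >].

Lemma hk_congb_refl : reflexive hk_congb.
Proof. by move=> u; apply/asboolP; apply: hk_cong_refl. Qed.

Lemma hk_congb_sym : symmetric hk_congb.
Proof. by move=> u v; apply/asboolP/asboolP; apply: hk_cong_sym. Qed.

Lemma hk_congb_trans : transitive hk_congb.
Proof.
move=> v u w /asboolP uv /asboolP vw.
by apply/asboolP; apply: hk_cong_trans uv vw.
Qed.

Canonical hk_equiv := EquivRel hk_congb hk_congb_refl hk_congb_sym hk_congb_trans.

Definition HK := {eq_quot hk_equiv}.
HB.instance Definition _ := Choice.on HK.
HB.instance Definition _ := EqQuotient.on HK.

Lemma hk_piP (u v : seq Q) : \pi_HK u = \pi_HK v <-> hk_cong u v.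
Proof.
by split=> [/eqmodP/asboolP //|uv]; apply/eqmodP; apply/asboolP.
Qed.

Definition hk_one : HK := \pi_HK [::].
Definition hk_mul (x y : HK) : HK := \pi_HK (repr x ++ repr y).
Definition hk_gen (i : Q) : HK := \pi_HK [:: i].

Lemma hk_mul_pi (u v : seq Q) : hk_mul (\pi_HK u) (\pi_HK v) = \pi_HK (u ++ v).
Proof.
by rewrite /hk_mul; apply/hk_piP; apply: hk_cong_cat; apply/hk_piP; rewrite reprK.
Qed.

Lemma hk_mulA : associative hk_mul.
Proof.
move=> x y z.
rewrite -[x]reprK -[y]reprK -[z]reprK.
by move: (repr x) (repr y) (repr z) => u v w; rewrite (hk_mul_pi v) (hk_mul_pi u v) !hk_mul_pi catA.
Qed.

Lemma hk_mul1 : left_id hk_one hk_mul.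
Proof. by move=> x; rewrite -[x]reprK; move: (repr x) => u; rewrite hk_mul_pi. Qed.

Lemma hk_mulr1 : right_id hk_one hk_mul.
Proof. by move=> x; rewrite -[x]reprK; move: (repr x) => u; rewrite hk_mul_pi cats0. Qed.

HB.instance Definition _ := isMonoid.Build HK hk_mulA hk_mul1 hk_mulr1.

End HeckeKiselman.

Definition finite_type (Q : digraph) : Prop := finite_set [set: HK Q]%classic.

Inductive Kvertex := Ka | Kb | Kc | Kd.

Definition nat_of_Kvertex (x : Kvertex) : nat :=
  match x with Ka => 0 | Kb => 1 | Kc => 2 | Kd => 3 end.

Definition Kvertex_of_nat (n : nat) : Kvertex :=
  match n with 0 => Ka | 1 => Kb | 2 => Kc | _ => Kd end.

Lemma nat_of_KvertexK : cancel nat_of_Kvertex Kvertex_of_nat.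
Proof. by case. Qed.

HB.instance Definition _ := Countable.copy Kvertex (can_type nat_of_KvertexK).

Definition Kedge : rel Kvertex := fun x y =>
  match x, y with
  | Ka, Kb | Kb, Ka | Kc, Kd | Kd, Kc => true
  | _, _ => false
  end.

Definition Karrow : rel Kvertex := fun x y =>
  match x, y with
  | Ka, Kc | Ka, Kd | Kb, Kc | Kb, Kd => true
  | _, _ => false
  end.

Lemma Kedge_irr : irreflexive Kedge. Proof. by case. Qed.
Lemma Karrow_irr : irreflexive Karrow. Proof. by case. Qed.
Lemma Kedge_sym : symmetric Kedge. Proof. by case; case. Qed.
Lemma Karrow_asym x y : Karrow x y -> ~~ Karrow y x.
Proof. by case: x; case: y. Qed.
Lemma Kedge_not_arrow x y : Kedge x y -> ~~ Karrow x y.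
Proof. by case: x; case: y. Qed.

Definition digraphK : digraph :=
  Digraph Kedge_irr Karrow_irr Kedge_sym Karrow_asym Kedge_not_arrow.

(* Main.v *)
From mathcomp Require Import all_boot.
From mathcomp Require Import boolp classical_sets cardinality.
Require Import Defs.

(** The powers of [b c a d] are pairwise distinct in [H_K]: the monoid acts on
    the right on a set of states carrying a counter, together with a sink, and
    [b c a d] increments the counter of the initial state.  The transitions are
    those of the right Cayley graph of [H_K] near the path spelled by
    [b c a d b c a d ...]: elements that cannot return to this path are sent to
    the sink, and those with the same outgoing transitions are identified. *)

Set Implicit Arguments.
Unset Strict Implicit.
Unset Printing Implicit Defensive.

Local Open Scope quotient_scope.

(* In the unflipped half, a factor [b c] is being read: [Start] has read
   nothing of it, [ReadB] has just read [b] and waits for [c], and [ReadC] has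
   read a superfluous [c] (since [c b c = b c]) and waits for [b]. *)
Inductive phase := Start | ReadB | ReadC.

(* [(flipped, phase, number of completed rounds)]; [None] is the sink. *)
Definition state := option (bool * phase * nat).

Definition swapK (x : Kvertex) : Kvertex :=
  match x with Ka => Kb | Kb => Ka | Kc => Kd | Kd => Kc end.

(* The automorphism [swapK] of the digraph turns the factor [b c] into [a d],
   so that the flipped half is the image of the unflipped one. *)
Definition step (s : state) (x : Kvertex) : state :=
  if s is Some (flipped, p, n) then
    match p, (if flipped then swapK x else x) with
    | Start, (Ka | Kd) => Some (flipped, Start, n)
    | (Start | ReadC), Kb => Some (flipped, ReadB, n)
    | Start, Kc => Some (flipped, ReadC, n)
    | ReadB, Kb => Some (flipped, ReadB, n)
    | ReadB, Kc => Some (~~ flipped, Start, flipped + n)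
    | ReadC, (Ka | Kc) => Some (flipped, ReadC, n)
    | _, _ => None
    end
  else None.

Definition act (s : state) (w : seq digraphK) : state := foldl step s w.

(** Transitions never inspect the counter, so [n] stays symbolic and a finite check over six live
    state shapes, the sink and all vertices suffices. *)
Lemma act_hk_relation (u v : seq digraphK) (s : state) :
  hk_relation u v -> act s u = act s v.
Proof.
by case: s => [[[[] []] n]|]; case=> [[]|[] []|[] []|[] []|[] []].
Qed.

Lemma act_hk_cong (u v : seq digraphK) (s : state) :
  hk_cong u v -> act s u = act s v.
Proof.
move=> uv; elim: uv s => {u v} [u v uv|u|u v _ IH|u v w _ IH1 _ IH2|
  u u' v v' _ IHu _ IHv] s.
- exact: act_hk_relation.
- by [].
- by rewrite IH.
- by rewrite IH1.
- by rewrite /act !foldl_cat -!/(act _ _) IHu IHv.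
Qed.

Definition bcad : seq digraphK := [:: Kb; Kc; Ka; Kd].

(** The initial counter [m] is general since each round raises it before the induction hypothesis
    applies. *)
Lemma act_bcad_pow (n m : nat) :
  act (Some (false, Start, m)) (flatten (nseq n bcad)) =
  Some (false, Start, n + m).
Proof.
by elim: n m => //= n IHn m; rewrite IHn addnS.
Qed.

(** Independent of the representative by [act_hk_cong]; 0 is a default at the sink. *)
Definition rounds (x : HK digraphK) : nat :=
  if act (Some (false, Start, 0)) (repr x) is Some (_, n) then n else 0.

Lemma rounds_bcad_pow (n : nat) :
  rounds (\pi_(HK digraphK) (flatten (nseq n bcad))) = n.
Proof.
have /hk_piP reprP := reprK (\pi_(HK digraphK) (flatten (nseq n bcad))).
by rewrite /rounds (act_hk_cong _ reprP) act_bcad_pow addn0.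
Qed.

Theorem lemma3p5 : ~ finite_type digraphK.
Proof.
(* The image of [rounds] is all of [nat], which is infinite. *)
move=> /(finite_image rounds) fin_rounds.
apply: infinite_nat; apply: sub_finite_set fin_rounds => n _.
by exists (\pi_(HK digraphK) (flatten (nseq n bcad))); last exact: rounds_bcad_pow.
Qed.
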